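(* Let $d\ge2$ be a fixed integer. There exist a function $c(r)$ with $c(r)=O(r^{d-1})=o(r^d)$ as $r\to\infty$, a constant $c_d>0$ depending only on $d$, and $r_0=r_0(d)$, such that for all $r\ge r_0$ and all positive integers $V$ with $V/d!\le\mathrm{vol}(B_r^d)$, $$V^{\frac{d-1}{d+1}}\le c_d\,\log\Bigl|\bigl\{P\in H_r^d:\ \mathrm{vol}(P)\ge\mathrm{vol}(B_r^d)-c(r)\bigr\}\Bigr| .$$
   Context: $B_r^d$ is the closed ball of radius $r$ centred at the origin in $\mathbb{R}^d$. A convex lattice polytope is the convex hull of a finite subset of $\mathbb{Z}^d$; polytopes here are $d$-dimensional. $H_r^d$ is the set of all convex lattice polytopes contained in $B_r^d$. *)

(* Defs.v *)
From mathcomp Require Export all_boot all_order all_algebra finmap.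
From mathcomp Require Export all_classical all_reals all_analysis.

Set Implicit Arguments.
Unset Strict Implicit.
Unset Printing Implicit Defensive.

Export Order.TTheory GRing.Theory Num.Theory.
Export numFieldNormedType.Exports.

Local Open Scope classical_set_scope.
Local Open Scope ring_scope.

(* The Landau notations only accept filters with a canonical instance, which
   the library does not declare for +oo. *)
Canonical pinfty_nbhs_filter_on (R : numFieldType) :=
  FilterType (pinfty_nbhs R) _.

Section LebesgueMeasureTuple.
Context (R : realType).
Local Open Scope ereal_scope.

Definition cons_pair (n : nat) (p : measurableTypeR R * n.-tuple (measurableTypeR R)) :
  n.+1.-tuple (measurableTypeR R) := [tuple of p.1 :: p.2].

(* n-dimensional Lebesgue measure as the n-fold product of the one-dimensional
   one: R^0 carries a unit mass and R^(n+1) is identified with R * R^n. *)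
Fixpoint lebesgue_tuple (n : nat) : set (n.-tuple (measurableTypeR R)) -> \bar R :=
  match n return set (n.-tuple (measurableTypeR R)) -> \bar R with
  | 0 => \d_([tuple])
  | m.+1 => pushforward (@lebesgue_measure R \x @lebesgue_tuple m) (@cons_pair m)
  end.

End LebesgueMeasureTuple.

Section LatticePolytopes.
Context (R : realType) (d : nat).
Implicit Types (A S P : set 'rV[R]_d) (r : R).

Definition vol A : \bar R :=
  @lebesgue_tuple R d [set t | A (\row_i tnth t i)].

(* The norm that the library puts on 'rV[R]_d is the sup norm, so Euclidean
   balls have to be defined separately. *)
Definition euclid_norm (x : 'rV[R]_d) : R := Num.sqrt (\sum_i x 0 i ^+ 2).

Definition euclid_cball r : set 'rV[R]_d := [set x | euclid_norm x <= r].

Definition int_lattice : set 'rV[R]_d := [set x | forall i, x 0 i \is a Num.int].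

Definition convex_hull S : set 'rV[R]_d :=
  smallest (@convex_set R 'rV[R]_d) S.

Definition affine_set A : Prop :=
  forall x y (t : R), A x -> A y -> A (t *: x + (1 - t) *: y).

Definition affine_hull A : set 'rV[R]_d := smallest affine_set A.

(* The dimension of P is that of its affine hull, which is d exactly when the
   affine hull is the whole space. *)
Definition full_dimensional P : Prop := affine_hull P = setT.

Definition lattice_polytope P : Prop :=
  (exists S, [/\ finite_set S, S `<=` int_lattice & P = convex_hull S]) /\
  full_dimensional P.

Definition lattice_polytopes_in_ball r : set (set 'rV[R]_d) :=
  [set P | lattice_polytope P /\ P `<=` euclid_cball r].

End LatticePolytopes.

Arguments euclid_cball {R} d r.
Arguments lattice_polytopes_in_ball {R} d r.

(* Main.v *)
Require Import Defs.
From mathcomp Require Import zify ring lra measurable_realfun.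
From Stdlib Require PeanoNat.

Local Open Scope classical_set_scope.
Local Open Scope ring_scope.

(** Put [L = s^2] with [s^(d+1)] of order [r].  If a family of lattice points
    has all its squared norms in one window [(M-L, M]] with [M <= r^2] and all
    its squared mutual distances at least [L], then each member is separated
    from the others, and from every lattice point of squared norm at most
    [M-L], by the hyperplane orthogonal to it.  Hence the hulls of the latter
    points together with an arbitrary subfamily are pairwise distinct, and
    they contain the ball of radius [r - O(1)], so they miss a volume
    [O(r^(d-1))] only.

    A family of order [s^(d(d-1))] comes from a counting argument.  Take the
    lattice points [x = (floor (sqrt (N^2 - |f|^2)), f)] just below a spherical
    cap, with [N] the integer part of [r] and [f] in a cube of side [n] a small
    multiple of [N]; their squared norms lie in [[N^2-2N, N^2]].  If [x] and
    [x+z] are in the same window and [|z|^2 < L], then [|<x,z>| < L].  For a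
    fixed [z] this slab contains about [n^(d-2) L/|z|] of the points, and
    summing over [|z| < s] discards at most half of them.  Pigeonholing the
    rest into the [O(N/L)] windows gives the family. *)

(** * Counting in finite types *)

Lemma card_exists_le (I T : finType) (P : I -> pred T) :
  (#|[pred x | [exists i, P i x]]| <= \sum_i #|P i|)%N.
Proof.
rewrite -sum1_card big_mkcond /=.
under [X in (_ <= X)%N]eq_bigr => i _ do rewrite -sum1_card big_mkcond /=.
rewrite exchange_big /=; apply: leq_sum => x _.
rewrite inE; case: existsP => // -[i Pix].
by rewrite (bigD1 i) //= unfold_in Pix.
Qed.

(** A member of [B] is determined by its value at [i] modulo [D.+1] together with its other values:
    on a line in direction [i] two members differ by at most [D], so equal residues force
    equality. *)
Lemma card_close_fibers (k n D : nat) (i : 'I_k.+1)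
    (B : pred {ffun 'I_k.+1 -> 'I_n}) :
  (forall f g, f \in B -> g \in B -> (forall j, j != i -> f j = g j) ->
    (f i <= g i)%N -> (g i - f i <= D)%N) ->
  (#|B| <= D.+1 * n ^ k)%N.
Proof.
move=> BD.
pose enc (f : {ffun 'I_k.+1 -> 'I_n}) :=
  (inord ((f i : nat) %% D.+1) : 'I_D.+1, [ffun j : 'I_k => f (lift i j)]).
have enc_inj : {in B &, injective enc}.
  move=> f g fB gB [/(congr1 val)]; rewrite /= !inordK ?ltn_mod// => fgi fgj.
  have off j : j != i -> f j = g j.
    case: (unliftP i j) => [j' ->|-> /eqP//] _.
    by have /ffunP/(_ j') := fgj; rewrite !ffunE.
  apply/ffunP => j; have [->|/off//] := eqVneq j i; apply/val_inj => /=.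
  wlog le_fg : f g fB gB fgi {fgj} off / (f i <= g i)%N => [wl|].
    case/orP: (leq_total (f i) (g i)) => [/wl|/wl H]; first exact.
    by apply/esym/H => // l /off.
  have := BD f g fB gB off le_fg; move/eqP: fgi.
  rewrite eq_sym eqn_mod_dvd// => /dvdnP[[|c] E]; last by lia.
  by move=> _; lia.
rewrite -(card_in_imset enc_inj) (leq_trans (max_card _))//.
by rewrite card_prod card_ffun !card_ord.
Qed.

(** * Separated lattice points in a thin spherical shell *)

Section ThinShell.
Variables (k n N : nat).
(** The ambient dimension is [k.+2]: a base cube of side [n] in [k.+1] coordinates, and one height.
    The cube is so small against [N] that the cap over it has slope below one half. *)
Hypothesis nN : (4 * k.+2 * n <= N)%N.
Local Notation fn := {ffun 'I_k.+1 -> 'I_n}.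

Definition base_norm (f : fn) : nat := \sum_i f i ^ 2.

(** [Nat.sqrt] rounds down, so this is the highest lattice point above [f] in the ball of radius
    [N]. *)
Definition height (f : fn) : nat := Nat.sqrt (N ^ 2 - base_norm f).

Definition point_norm (f : fn) : nat := height f ^ 2 + base_norm f.

Definition point_dot (f : fn) (z0 : int) (z : 'I_k.+1 -> int) : int :=
  (height f)%:Z * z0 + \sum_i (f i)%:Z * z i.

Lemma base_norm_le (f : fn) : (16 * base_norm f <= N ^ 2)%N.
Proof.
have : (base_norm f <= k.+1 * n ^ 2)%N.
  rewrite -[X in (_ <= X * _)%N](card_ord k.+1) -sum_nat_const.
  by apply: leq_sum => i _; have := ltn_ord (f i); nia.
by nia.
Qed.

Lemma height_spec (f : fn) :
  (height f ^ 2 + base_norm f <= N ^ 2 < (height f).+1 ^ 2 + base_norm f)%N.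
Proof.
have := PeanoNat.Nat.sqrt_spec' (N ^ 2 - base_norm f)%N.
have := base_norm_le f; rewrite -/(height f) => ?; lia.
Qed.

Lemma height_ge (f : fn) : (N <= (2 * height f).+1)%N.
Proof. have := height_spec f; have := base_norm_le f; nia. Qed.

Lemma height_le (f : fn) : (height f <= N)%N.
Proof. have := height_spec f; nia. Qed.

Lemma point_norm_bounds (f : fn) :
  (point_norm f <= N ^ 2 <= point_norm f + 2 * N)%N.
Proof.
have := height_spec f; have := height_le f; rewrite /point_norm; nia.
Qed.

(** Let [hf], [hg] be the heights and [a], [b] the values at [i]. Rounding down gives [(hf - hg - 1)
    (hf + hg + 1) <= (b - a) (b + a)], where [hf + hg + 1 >= 4 n] and [b + a <= 2 n]. The [+ 2] pays
    for the rounding. *)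
Lemma height_lipschitz (f g : fn) (i : 'I_k.+1) :
    (forall j, j != i -> f j = g j) -> (f i <= g i)%N ->
  (height g <= height f)%N /\ (2 * (height f - height g) <= (g i - f i) + 2)%N.
Proof.
move=> off le_fg.
have : (base_norm g + f i ^ 2 = base_norm f + g i ^ 2)%N.
  have E : (\sum_(j | j != i) f j ^ 2 = \sum_(j | j != i) g j ^ 2)%N.
    by apply: eq_bigr => j /off ->.
  rewrite /base_norm (bigD1 i) //= [in RHS](bigD1 i) //= E.
  by rewrite addnC -!addnA; congr (_ + _)%N; exact: addnC.
have := height_spec f; have := height_spec g; have := height_ge f.
have := height_ge g; have := ltn_ord (f i); have := ltn_ord (g i).
move: (nat_of_ord (f i)) (nat_of_ord (g i)) le_fg => a b.
move: (height f) (height g) (base_norm f) (base_norm g) => hf hg bf bg.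
move=> ab bn an Hg Hf sg sf E.
have ab2 : (a ^ 2 <= b ^ 2)%N by rewrite leq_sqr.
have le_h : (hg <= hf)%N.
  by rewrite leqNgt; apply/negP; rewrite -leq_sqr; lia.
split => //.
have n_gt0 : (0 < n)%N by lia.
have H : ((hf - hg.+1) * (hf + hg.+1) <= (b - a) * (2 * n))%N.
  apply: (@leq_trans (b ^ 2 - a ^ 2)%N); first by rewrite -subn_sqr; lia.
  by rewrite subn_sqr leq_mul2l; apply/orP; right; lia.
have Nh : (4 * n <= hf + hg.+1)%N.
  have : (4 * n <= 4 * k.+2 * n)%N by rewrite leq_mul2r leq_pmulr ?orbT.
  by lia.
have : ((hf - hg.+1) * (4 * n) <= (b - a) * (2 * n))%N.
  by apply: leq_trans H; rewrite leq_mul2l Nh orbT.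
rewrite [X in (_ <= X)%N -> _]mulnA [X in (X <= _)%N -> _]mulnA leq_pmul2r//; lia.
Qed.

(** The base coordinates contribute at most [N m / 4] and [L <= N / 8], whereas [|z0| > m] would
    make the height term at least [(m + 1) (N - 1) / 2]. *)
Lemma point_dot_coord0_le (f : fn) (z0 : int) (z : 'I_k.+1 -> int) (L m : nat) :
    (8 * L <= N)%N -> (2 <= N)%N -> (forall i, `|z i| <= m)%N ->
  (`|point_dot f z0 z| < L)%N -> (`|z0| <= m)%N.
Proof.
move=> LN N2 zm dotL.
have sumle : (`|(\sum_i (f i)%:Z * z i)%R| <= k.+1 * (n * m))%N.
  have : `|\sum_i (f i)%:Z * z i| <= \sum_(i < k.+1) (n * m)%:Z :> int.
    rewrite (le_trans (ler_norm_sum _ _ _))// ler_sum// => i _.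
    by have := zm i; have := ltn_ord (f i); rewrite normrM; nia.
  by rewrite sumr_const card_ord; lia.
move: dotL; rewrite /point_dot; have := height_ge f.
move: (height f) (\sum_i _) sumle => h S Sle hN dotL.
have : (h * `|z0| < L + k.+1 * (n * m))%N by rewrite -[h in (h * _)%N]absz_nat -abszM; lia.
have : (4 * (k.+1 * (n * m)) <= N * m)%N by nia.
by rewrite leqNgt; move=> ? ?; apply/negP => ?; nia.
Qed.

(* A direction with largest base coordinate [m.+1], attained at [i], is coded
   by a single function: slot [i], whose value is known, stores the height
   coordinate. *)
Definition coded_dir (i : 'I_k.+1) (m : nat)
    (u : {ffun 'I_k.+1 -> 'I_(2 * m.+1).+1}) (j : 'I_k.+1) : int :=
  if j == i then m.+1%:Z else (u j)%:Z - m.+1%:Z.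

Definition near_orthogonal (L : nat) (i : 'I_k.+1) (m : nat)
    (u : {ffun 'I_k.+1 -> 'I_(2 * m.+1).+1}) (f : fn) : bool :=
  (`|point_dot f ((u i)%:Z - m.+1%:Z)%R (coded_dir i m u)| < L)%N.

(** The points almost orthogonal to some short direction. A direction matters only up to sign, so
    its largest base coordinate is taken positive. *)
Definition bad (s : nat) : pred fn :=
  [pred f | [exists i, exists m : 'I_s, exists u, near_orthogonal (s ^ 2) i m u f]].

(* Along direction [i] the height changes by at most half of the change of
   [f i], up to rounding, and [|z0| <= z i], so the dot product moves at speed
   at least [m.+1 / 2]. *)
Lemma card_near_orthogonal (L m : nat) (i : 'I_k.+1)
    (u : {ffun 'I_k.+1 -> 'I_(2 * m.+1).+1}) :
  (#|near_orthogonal L i m u| <= ((4 * L + 2 * m.+1) %/ m.+1).+1 * n ^ k)%N.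
Proof.
apply: (@card_close_fibers _ _ _ i) => f g fB gB off le_fg.
rewrite leq_divRL//.
have [le_h dh] := height_lipschitz f g i off le_fg.
pose z0 : int := (u i)%:Z - m.+1%:Z.
pose rest (h : fn) : int := \sum_(j | j != i) (h j)%:Z * coded_dir i m u j.
have dotE h : point_dot h z0 (coded_dir i m u) =
    (height h)%:Z * z0 + ((h i)%:Z * m.+1%:Z + rest h).
  by rewrite /point_dot (bigD1 i)//= {1}/coded_dir eqxx.
have restE : rest f = rest g by apply: eq_bigr => j /off ->.
have z0m : (`|z0| <= m.+1)%N by have := ltn_ord (u i); rewrite /z0; lia.
move: fB gB; rewrite !unfold_in /near_orthogonal -/z0 !dotE restE.
clear dotE; move: (rest g) => S; clear rest restE; clearbody z0.
move: (nat_of_ord (f i)) (nat_of_ord (g i)) le_fg dh => a b le_ab.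
move: (height f) (height g) le_h => hf hg le_h dh Hf Hg.
have K1 : (m.+1 * (b - a) <= `|z0| * (hf - hg) + 2 * L)%N.
  have -> : (`|z0| * (hf - hg) = `|(z0 * (hf%:Z - hg%:Z))%R|)%N.
    by rewrite abszM; congr muln; lia.
  have : ((b%:Z - a%:Z) * m.+1%:Z = (z0 * (hf%:Z - hg%:Z)) +
    ((hg%:Z * z0 + (b%:Z * m.+1%:Z + S)) - (hf%:Z * z0 + (a%:Z * m.+1%:Z + S))))%R by ring.
  have -> : (m.+1 * (b - a) = `|((b%:Z - a%:Z) * m.+1%:Z)%R|)%N.
    by rewrite abszM mulnC; congr muln; lia.
  by move=> ->; lia.
have K2 : (`|z0| * (hf - hg) <= m.+1 * (hf - hg))%N by rewrite leq_mul2r z0m orbT.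
have K3 : (m.+1 * (2 * (hf - hg)) <= m.+1 * (b - a + 2))%N.
  by rewrite leq_mul2l dh orbT.
by rewrite [X in (X <= _)%N]mulnC; lia.
Qed.

(** The factors count the positions [i] of the largest coordinate, bound the thickness of a slab
    ([7 = 4 + 2 + 1]) and bound the number of codes [u]. *)
Definition bad_const : nat := 7 * k.+1 * 3 ^ k.+1.

(** Longer directions are more numerous but cut thinner slabs: for largest coordinate [m.+1] there
    are [O(m.+1 ^ k.+1)] codes, each with [O(s ^ 2 / m.+1) * n ^ k] points. This is
    [O(s ^ k.+2) * n ^ k] for each of the [s] values of [m]. *)
Lemma card_bad (s : nat) : (#|bad s| <= bad_const * s ^ k.+3 * n ^ k)%N.
Proof.
apply: leq_trans (card_exists_le _ _ _) _.
have bound (i : 'I_k.+1) (m : 'I_s) :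
    (#|[pred f : fn | [exists u, near_orthogonal (s ^ 2) i m u f]]|
      <= 7 * 3 ^ k.+1 * s ^ k.+2 * n ^ k)%N.
  apply: leq_trans (card_exists_le _ _ _) _.
  pose c : nat := ((4 * s ^ 2 + 2 * m.+1) %/ m.+1).+1 * n ^ k.
  apply: (@leq_trans (\sum_(u : {ffun 'I_k.+1 -> 'I_(2 * m.+1).+1}) c)).
    by apply: leq_sum => u _; exact: card_near_orthogonal.
  rewrite /c sum_nat_const card_ffun !card_ord mulnA leq_mul2r; apply/orP; right.
  have ms := ltn_ord m.
  have A1 : ((2 * m.+1).+1 ^ k.+1 <= 3 ^ k.+1 * m.+1 ^ k.+1)%N.
    by rewrite -expnMn leq_exp2r//; lia.
  have A2 : (m.+1 * ((4 * s ^ 2 + 2 * m.+1) %/ m.+1).+1 <= 7 * s ^ 2)%N.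
    have B1 := leq_divM (4 * s ^ 2 + 2 * m.+1) m.+1.
    have B2 : (m.+1 <= s ^ 2)%N by rewrite (leq_trans ms)// -mulnn leq_pmulr// (leq_ltn_trans _ ms).
    by rewrite mulnS mulnC; lia.
  apply: leq_trans (leq_mul A1 (leqnn _)) _.
  move: ((_ %/ _).+1) A2 => D A2.
  rewrite (_ : _ * D = 3 ^ k.+1 * (m.+1 ^ k * (m.+1 * D)))%N; last first.
    by rewrite [(m.+1 ^ k.+1)%N]expnSr; lia.
  rewrite (_ : 7 * 3 ^ k.+1 * _ = 3 ^ k.+1 * (s ^ k * (7 * s ^ 2)))%N; last first.
    by rewrite -(addn2 k) expnD; lia.
  rewrite leq_mul2l; apply/orP; right; apply: leq_mul A2.
  by case: (k) => // k'; rewrite leq_exp2r.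
have bound' (i : 'I_k.+1) :
    (#|[pred f : fn | [exists m : 'I_s, exists u, near_orthogonal (s ^ 2) i m u f]]|
      <= s * (7 * 3 ^ k.+1 * s ^ k.+2 * n ^ k))%N.
  apply: leq_trans (card_exists_le _ _ _) _.
  rewrite -[X in (_ <= X * _)%N](card_ord s) -sum_nat_const.
  by apply: leq_sum => m _; exact: bound.
apply: leq_trans (_ : \sum_(i < k.+1) s * (7 * 3 ^ k.+1 * s ^ k.+2 * n ^ k) <= _)%N.
  by apply: leq_sum => i _; exact: bound'.
rewrite sum_nat_const card_ord /bad_const (expnS _ k.+2).
by apply/eq_leq; lia.
Qed.

(** Choosing [i] with [|z i|] maximal and changing sign brings [(z0, z)] to coded form; the near
    orthogonality itself forces [|z0| <= z i], so that [z0] fits into slot [i]. *)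
Lemma bad_intro (s : nat) (f : fn) (z0 : int) (z : 'I_k.+1 -> int) :
    (8 * s ^ 2 <= N)%N -> (2 <= N)%N ->
    (exists i, z i != 0) -> (forall i, `|z i| <= s)%N ->
  (`|point_dot f z0 z| < s ^ 2)%N -> bad s f.
Proof.
move=> sN N2 [i1 zi1] zs.
have {i1 zi1} [i zi0 zi] : exists2 i, z i != 0 & forall j, (`|z j| <= `|z i|)%N.
  case: (@arg_maxnP _ i1 predT (fun i => `|z i|%N) isT) => i _ imax.
  exists i => [|j]; last exact: imax.
  by rewrite -absz_gt0 (leq_trans _ (imax i1 isT))// absz_gt0.
wlog zi_gt0 : z0 z zs zi0 zi / 0 < z i => [wl|].
  have [zin|zip|zi_eq0] := ltgtP (z i) 0;
    [|exact: wl|by rewrite zi_eq0 eqxx in zi0].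
  move=> dots; apply: (wl (- z0) (fun j => - z j)).
  - by move=> j; rewrite abszN.
  - by rewrite oppr_eq0 lt_eqF.
  - by move=> j; rewrite !abszN.
  - by rewrite oppr_gt0.
  - rewrite [point_dot _ _ _](_ : _ = - point_dot f z0 z) ?abszN//.
    rewrite /point_dot opprD mulrN; congr (_ + _).
    by rewrite -sumrN; apply: eq_bigr => j _; rewrite mulrN.
move=> dots.
have z0m : (`|z0| <= `|z i|)%N by apply: (point_dot_coord0_le _ _ _ _ _ sN N2 zi dots).
have [m Em] : exists m, z i = m.+1%:Z.
  by exists (`|z i|.-1)%N; rewrite prednK ?absz_gt0// gtz0_abs.
have ms : (m < s)%N by have := zs i; rewrite Em.
rewrite Em absz_nat in zi z0m.
apply/existsP; exists i; apply/existsP; exists (Ordinal ms); apply/existsP.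
(* Adding [m.+1] moves the range from [-m.+1] to [m.+1] onto the ordinals below [(2 * m.+1).+1]. *)
exists [ffun j => inord `|(if j == i then z0 else z j) + m.+1%:Z|]; rewrite /near_orthogonal /=.
rewrite [point_dot _ _ _](_ : _ = point_dot f z0 z)//.
rewrite /point_dot ffunE eqxx inordK; last by lia.
congr (_ * _ + _); first by lia.
apply: eq_bigr => j _; congr (_ * _); rewrite /coded_dir ffunE.
case: eqP => [->//|_]; have := zi j => ?; rewrite inordK; by lia.
Qed.

Definition point_dist (f g : fn) : int :=
  ((height g)%:Z - (height f)%:Z) ^+ 2 + \sum_i ((g i)%:Z - (f i)%:Z) ^+ 2.

(* With [z = y - x], [2 <x,z> = |y|^2 - |x|^2 - |z|^2], so two close points in
   the same window make the first one bad. *)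
Lemma good_separated (s : nat) (f g : fn) :
    (8 * s ^ 2 <= N)%N -> (2 <= N)%N -> f != g -> ~~ bad s f ->
    (point_norm f < point_norm g + s ^ 2)%N ->
    (point_norm g < point_norm f + s ^ 2)%N ->
  (s ^ 2)%:Z <= point_dist f g.
Proof.
move=> sN N2 fg good_f nfg ngf; rewrite leNgt; apply/negP => dist_lt.
move/negP: good_f; apply.
pose z0 : int := (height g)%:Z - (height f)%:Z.
pose z (i : 'I_k.+1) : int := (g i)%:Z - (f i)%:Z.
apply: (bad_intro _ _ z0 z sN N2).
- have /existsP[i fgi] : [exists i, f i != g i].
    apply: contraNT fg; rewrite negb_exists => /forallP H.
    by apply/eqP/ffunP => i; apply/eqP; have := H i; rewrite negbK.
  exists i; rewrite /z subr_eq0; apply: contra fgi => /eqP[] E.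
  by apply/eqP/val_inj.
- move=> i; rewrite -leq_sqr -lez_nat.
  apply: le_trans (ltW dist_lt); rewrite /point_dist (bigD1 i)//= addrCA.
  rewrite [((`|z i| ^ 2)%N)%:Z](_ : _ = z i ^+ 2); last first.
    by rewrite -mulnn PoszM -expr2 abszE real_normK ?num_real.
  by rewrite lerDl addr_ge0 ?sqr_ge0// sumr_ge0// => j _; rewrite sqr_ge0.
- have normE h : (point_norm h)%:Z = (height h)%:Z ^+ 2 + \sum_i (h i)%:Z ^+ 2.
    rewrite /point_norm /base_norm PoszD -mulnn PoszM -expr2; congr (_ + _).
    rewrite (big_morph Posz PoszD (erefl _)).
    by apply: eq_bigr => i _; rewrite -mulnn PoszM -expr2.
  have : 2 * point_dot f z0 z = (point_norm g)%:Z - (point_norm f)%:Z - point_dist f g.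
    rewrite !normE /point_dist /point_dot.
    rewrite [X in _ = X](_ : _ = (height g)%:Z ^+ 2 - (height f)%:Z ^+ 2 -
        ((height g)%:Z - (height f)%:Z) ^+ 2 + (\sum_i (g i)%:Z ^+ 2 -
        \sum_i (f i)%:Z ^+ 2 - \sum_i ((g i)%:Z - (f i)%:Z) ^+ 2)); last by ring.
    rewrite mulrDr -!sumrB mulr_sumr; congr (_ + _); first by rewrite /z0; ring.
    by apply: eq_bigr => i _; rewrite /z; ring.
  have : 0 <= point_dist f g.
    by rewrite addr_ge0 ?sqr_ge0// sumr_ge0// => j _; rewrite sqr_ge0.
  by move: dist_lt; lia.
Qed.

(** The lower bound on [n] makes at most half of the points bad; the good ones are distributed over
    the windows of width [s ^ 2], and some window holds at least the average. *)
Lemma card_good_shell (s : nat) :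
    (0 < s)%N -> (2 * (bad_const * s ^ k.+3) <= n)%N ->
  exists j : nat, (j * s ^ 2 <= 2 * N)%N /\
    (n ^ k.+1 <= 2 * #|[pred f : fn | ~~ bad s f &
       ((N ^ 2 - point_norm f) %/ s ^ 2 == j)%N]| * ((2 * N) %/ s ^ 2).+1)%N.
Proof.
move=> s_gt0 sn; set K := ((2 * N) %/ s ^ 2).+1.
pose P (j : 'I_K) : pred fn := [pred f | ~~ bad s f &
       ((N ^ 2 - point_norm f) %/ s ^ 2 == j)%N].
have badn : (2 * #|bad s| <= n ^ k.+1)%N.
  apply: (@leq_trans (2 * (bad_const * s ^ k.+3 * n ^ k))).
    by rewrite leq_mul2l card_bad orbT.
  by rewrite mulnA (expnS n) leq_mul2r sn orbT.
have goodn : (n ^ k.+1 <= 2 * #|predC (bad s)|)%N.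
  have : (#|bad s| + #|predC (bad s)| = n ^ k.+1)%N.
    by rewrite cardC card_ffun !card_ord.
  by move: badn; move: (#|_|) (#|_|) (n ^ _)%N => a b c; lia.
have good_sum : (#|predC (bad s)| <= \sum_j #|P j|)%N.
  apply: leq_trans (card_exists_le _ _ _); apply/subset_leq_card/fintype.subsetP => f.
  move=> good_f; rewrite inE; apply/existsP.
  have jK : ((N ^ 2 - point_norm f) %/ s ^ 2 < K)%N.
    by rewrite ltnS leq_div2r//; have := point_norm_bounds f; lia.
  by exists (Ordinal jK); apply/andP; split; [exact: good_f|exact: eqxx].
have [j Hj|none] := pickP [pred j | (n ^ k.+1 <= 2 * #|P j| * K)%N].
  exists j; split; last exact: Hj.
  have := ltn_ord j; rewrite /K ltnS leq_divRL ?expn_gt0 ?s_gt0//.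
(* If every window failed, summing the strict inequalities, whose strictness is the [+ 1], would
   contradict [good_sum]. *)
have : (\sum_(j < K) (2 * #|P j| * K + 1) <= \sum_(j < K) n ^ k.+1)%N.
  by apply: leq_sum => j _; have /= := none j; lia.
rewrite big_split /= -big_distrl -big_distrr /= !sum_nat_const card_ord muln1.
have : (K * n ^ k.+1 <= K * (2 * \sum_j #|P j|))%N.
  by rewrite leq_mul2l (leq_trans goodn)// leq_mul2l good_sum orbT.
have : (0 < K)%N by [].
move: (n ^ _)%N (\sum_j _)%N => T S; lia.
Qed.

End ThinShell.

Arguments height {k n} N f.
Arguments point_norm {k n} N f.
Arguments point_dist {k n} N f g.

(** * Convex hulls, affine hulls and Euclidean balls *)

Section Geometry.
Context (R : realType) (d : nat).
Implicit Types (x y u v : 'rV[R]_d) (A S : set 'rV[R]_d).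

Lemma convex_setP A :
  convex_set (A : set (convex_lmodType 'rV[R]_d)) <->
  forall x y (t : R), 0 <= t <= 1 -> A x -> A y -> A (t *: x + (1 - t) *: y).
Proof.
split=> [cA x y t /andP[t0 t1] Ax Ay|cA x y t].
  have := cA x y (@Itv01 _ _ t0 t1); rewrite !inE => /(_ Ax Ay).
  by rewrite /conv /=.
rewrite !inE => Ax Ay; rewrite /conv /=; apply: cA => //.
by rewrite ge0 le1.
Qed.

Lemma sub_convex_hull S : S `<=` convex_hull S.
Proof. exact: sub_smallest. Qed.

Lemma convex_hull_min S A :
  convex_set (A : set (convex_lmodType 'rV[R]_d)) -> S `<=` A -> convex_hull S `<=` A.
Proof. by move=> cA SA; exact: smallest_sub. Qed.

Lemma convex_hull_convex S :
  convex_set (convex_hull S : set (convex_lmodType 'rV[R]_d)).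
Proof.
apply/convex_setP => x y t t01 Sx Sy A [cA SA].
by apply: (iffLR (convex_setP A) cA) => //; [apply: Sx|apply: Sy].
Qed.

Definition dot x y : R := \sum_i x 0 i * y 0 i.

Lemma dot_ge0 x : 0 <= dot x x.
Proof. by rewrite sumr_ge0// => i _; rewrite -expr2 sqr_ge0. Qed.

Lemma dot_comb x y u (t : R) :
  dot (t *: x + (1 - t) *: y) u = t * dot x u + (1 - t) * dot y u.
Proof.
rewrite /dot !mulr_sumr -big_split /=; apply: eq_bigr => i _.
by rewrite !mxE; ring.
Qed.

Lemma dot_sub x y : dot (x - y) (x - y) = dot x x + dot y y - 2 * dot y x.
Proof.
rewrite /dot mulr_sumr -big_split -sumrB /=; apply: eq_bigr => i _.
by rewrite !mxE; ring.
Qed.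

Lemma coord_sqr_le_dot x i : x 0 i ^+ 2 <= dot x x.
Proof.
rewrite /dot (bigD1 i)//= -expr2 lerDl sumr_ge0// => j _.
by rewrite -expr2 sqr_ge0.
Qed.

Lemma euclid_cballE (r : R) x : 0 <= r -> euclid_cball d r x <-> dot x x <= r ^+ 2.
Proof.
move=> r0; rewrite /euclid_cball /euclid_norm /=.
have -> : dot x x = \sum_i x 0 i ^+ 2 by apply: eq_bigr => i _; rewrite expr2.
rewrite -{1}(ger0_norm r0) -sqrtr_sqr ler_sqrt ?sqr_ge0//.
Qed.

Lemma convex_half_space u (c : R) :
  convex_set ([set x | dot x u < c] : set (convex_lmodType 'rV[R]_d)).
Proof.
apply/convex_setP => x y t /andP[t0 t1] /= xc yc; rewrite dot_comb.
by have [->|t_neq0] := eqVneq t 0; nra.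
Qed.

Lemma convex_euclid_cball (r : R) : 0 <= r ->
  convex_set (euclid_cball d r : set (convex_lmodType 'rV[R]_d)).
Proof.
move=> r0; apply/convex_setP => x y t /andP[t0 t1].
move=> /(euclid_cballE _ _ r0) xr /(euclid_cballE _ _ r0) yr.
apply/(euclid_cballE _ _ r0).
apply: (@le_trans _ _ (t * dot x x + (1 - t) * dot y y)); last by nra.
rewrite /dot !mulr_sumr -big_split /=; apply: ler_sum => i _.
rewrite !mxE; move: (x 0 i) (y 0 i) => a b.
have : 0 <= t * (1 - t) * (a - b) ^+ 2 by rewrite mulr_ge0 ?sqr_ge0 ?mulr_ge0 ?subr_ge0.
by nra.
Qed.

(** The integer coordinates of a corner are replaced by those of [u] one at a time: each new point
    lies on the segment between two earlier ones, with the floor of the coordinate of [u] and that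
    floor plus 1 in the current slot. *)
Lemma convex_of_cube_corners A u :
    convex_set (A : set (convex_lmodType 'rV[R]_d)) ->
    (forall v, v \in @int_lattice R d -> (forall i, `|v 0 i - u 0 i| <= 1) -> A v) ->
  A u.
Proof.
move=> cA corners.
suff H (k : nat) v : (forall i, `|v 0 i - u 0 i| <= 1) ->
    (forall i : 'I_d, (i < k)%N -> v 0 i = u 0 i) ->
    (forall i : 'I_d, (k <= i)%N -> v 0 i \is a Num.int) -> A v.
  apply: (H d u) => // [i|i]; first by rewrite subrr normr0.
  by rewrite leqNgt ltn_ord.
elim: k v => [|k IH] v v1 vu vint.
  by apply: corners => //; rewrite inE => i; exact: vint.
have [kd|dk] := ltnP k d; last first.
  by apply: IH => // i; [move=> ik; apply: vu; exact: ltnW|rewrite leqNgt (leq_trans _ dk)].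
pose i0 := Ordinal kd; pose a := u 0 i0.
pose fl : R := (Num.floor a)%:~R.
have fl_le : fl <= a by rewrite /fl real_floor_le ?num_real.
have fl_gt : a < fl + 1 by have := real_floorD1_gt (num_real a); rewrite intrD.
pose w (c : R) : 'rV[R]_d := \row_i (if i == i0 then c else v 0 i).
have wA c : c \is a Num.int -> `|c - a| <= 1 -> A (w c).
  move=> cint c1; apply: IH => i.
  - by rewrite mxE; case: eqP => [->|].
  - by rewrite mxE => ik; rewrite -val_eqE /= ltn_eqF// vu// ltnS ltnW.
  - rewrite mxE; have [//|ii0] := eqVneq i i0.
    rewrite leq_eqVlt => /predU1P[E|]; last exact: vint.
    by move/eqP: ii0; case; apply/val_inj.
have -> : v = (a - fl) *: w (fl + 1) + (1 - (a - fl)) *: w fl.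
  apply/rowP => i; rewrite !mxE; case: eqVneq => [->|_]; last by ring.
  by rewrite vu// -/a; ring.
apply: (iffLR (convex_setP A) cA); first lra.
  by apply: wA; [rewrite rpredD ?rpred1 ?intr_int|rewrite ler_norml; lra].
by apply: wA; [rewrite intr_int|rewrite ler_norml; lra].
Qed.

(** A lattice point at sup distance at most 1 from [u] has squared norm at most
    [rho ^ 2 + d (2 rho + 1) <= (rho + d) ^ 2], so it belongs to [S]; such points have [u] in their
    hull. *)
Lemma lattice_hull_sub_cball (m rho : R) S : 0 <= rho -> (rho + d%:R) ^+ 2 <= m ->
    (@int_lattice R d `&` [set x | dot x x <= m]) `<=` S ->
  euclid_cball d rho `<=` convex_hull S.
Proof.
move=> rho0 rhom mS u /(euclid_cballE _ _ rho0) urho.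
apply: convex_of_cube_corners; first exact: convex_hull_convex.
move=> v; rewrite inE => vint uv; apply: sub_convex_hull; apply: mS; split => //=.
have ui i : `|u 0 i| <= rho.
  rewrite -ler_sqr ?nnegrE// real_normK ?num_real//.
  exact: le_trans (coord_sqr_le_dot u i) urho.
have : dot v v <= dot u u + \sum_(i < d) (2 * rho + 1).
  rewrite /dot -big_split /=; apply: ler_sum => i _.
  have := uv i; have := ui i; rewrite !ler_norml; nra.
rewrite sumr_const card_ord -mulr_natr => /le_trans; apply.
apply: le_trans rhom; have : 0 <= d%:R :> R by [].
have : d%:R <= d%:R ^+ 2 :> R by rewrite -natrX ler_nat; case: (d) => // d'; rewrite -mulnn leq_pmulr.
by nra.
Qed.

(** An affine set through 0 is closed under scaling (combine with 0) and under addition (twice a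
    midpoint); the unit ball supplies 0 and the basis vectors. *)
Lemma affine_hull_cball1 A : euclid_cball d 1 `<=` A -> affine_hull A = setT.
Proof.
move=> ballA; apply/seteqP; split => // x _ H [affH AH].
have ballH u : dot u u <= 1 -> H u.
  by move=> u1; apply: AH; apply: ballA; apply/euclid_cballE; rewrite ?expr1n.
have H0 : H 0.
  by apply: ballH; rewrite /dot big1// => i _; rewrite mxE mul0r.
have HZ t u : H u -> H (t *: u).
  by move=> Hu; have := affH _ _ t Hu H0; rewrite scaler0 addr0.
have HD u v : H u -> H v -> H (u + v).
  move=> Hu Hv; have := HZ 2 _ (affH _ _ (2^-1) Hu Hv).
  rewrite (_ : 1 - 2^-1 = 2^-1 :> R); last by field.
  by rewrite -scalerDr scalerA divff// scale1r.
rewrite (row_sum_delta x); apply: big_ind => // i _; apply: HZ; apply: ballH.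
rewrite /dot (bigD1 i)//= big1 => [|j ji]; rewrite !mxE ?eqxx ?(negbTE ji) /=.
  by rewrite mulr1 addr0.
by rewrite mul0r.
Qed.

End Geometry.

Arguments dot {R d} x y.

(** * Lebesgue measure and the volume of balls *)

(** Lebesgue measure equals [a] times its pushforward under multiplication by [a], by uniqueness
    from the values on half-open intervals. *)
Lemma lebesgue_integral_dilate (R : realType) (a : R) (f : R -> \bar R) :
    0 < a -> measurable_fun setT f -> (forall x, (0 <= f x)%E) ->
  (\int[lebesgue_measure]_x f x = a%:E * \int[lebesgue_measure]_x f (a * x)%R)%E.
Proof.
move=> a_gt0 mf f_ge0.
have ma : measurable_fun [set: measurableTypeR R] ( *%R a : _ -> measurableTypeR R).
  exact: mulrl_measurable.
pose push : {measure set (measurableTypeR R) -> \bar R} :=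
  @measure_function_pushforward__canonical__measure_function_Measure _ _ _ _ _ lebesgue_measure _ ma.
pose nu : {measure set (measurableTypeR R) -> \bar R} :=
  [the measure _ _ of mscale (NngNum (ltW a_gt0)) push].
have nuE (A : set R) : measurable A -> A `<=` setT -> lebesgue_measure A = nu A.
  move=> mA _; apply: lebesgue_measure_unique mA => X [[x y] _ <-] /=.
  rewrite /nu /push /mscale /pushforward /=.
  rewrite /pushforward; have -> : *%R a @^-1` `]x, y] = `]x / a, y / a]%classic.
    by apply/seteqP; split => z /=; rewrite !in_itv/= ltr_pdivrMr// ler_pdivlMr// mulrC.
  rewrite !lebesgue_measure_itv/= !lte_fin ltr_pM2r ?invr_gt0//.
  by case: ltP => // xy; rewrite ?mule0// -!EFinB -EFinM; congr EFin; field; lra.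
rewrite (eq_measure_integral nu)// ge0_integral_mscale//=.
by rewrite ge0_integral_pushforward.
Qed.

(* [vol] of an arbitrary set is an iterated integral of possibly nonmeasurable
   functions; monotonicity survives because [\int] is a supremum over simple
   functions. *)
Lemma ge0_le_integral_nonmeas (d : measure_display) (T : measurableType d)
    (R : realType) (mu : {measure set T -> \bar R}) (f g : T -> \bar R) :
    (forall x, (0 <= f x)%E) -> (forall x, (f x <= g x)%E) ->
  (\int[mu]_x f x <= \int[mu]_x g x)%E.
Proof.
move=> f_ge0 fg; have g_ge0 x : (0 <= g x)%E := le_trans (f_ge0 x) (fg x).
rewrite !ge0_integralTE//; apply: le_ereal_sup => _ [h hf <-].
by exists h => // x; exact: le_trans (hf x) (fg x).
Qed.

Section LebesgueTuple.
Context (R : realType).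

Lemma lebesgue_tupleS (m : nat) (A : set (m.+1.-tuple R)) :
  @lebesgue_tuple R m.+1 A =
  (\int[lebesgue_measure]_x @lebesgue_tuple R m [set t | A (cons_pair (x, t))])%E.
Proof.
rewrite /= /pushforward /product_measure1; apply: eq_integral => x _ /=.
by congr lebesgue_tuple; apply/seteqP; split => t; rewrite /xsection /= inE.
Qed.

Lemma lebesgue_tuple_ge0 (m : nat) (A : set (m.-tuple R)) :
  (0 <= @lebesgue_tuple R m A)%E.
Proof.
elim: m A => [A|m IH A]; first by rewrite /= measure_ge0.
by rewrite lebesgue_tupleS; apply: integral_ge0.
Qed.

Lemma le_lebesgue_tuple (m : nat) (A B : set (m.-tuple R)) :
  A `<=` B -> (@lebesgue_tuple R m A <= @lebesgue_tuple R m B)%E.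
Proof.
elim: m A B => [A B AB|m IH A B AB].
  rewrite /= !diracE lee_fin ler_nat.
  case: (boolP ([tuple] \in A)) => //; rewrite inE => /AB.
  by rewrite -inE => ->.
rewrite !lebesgue_tupleS; apply: ge0_le_integral_nonmeas => x.
  exact: lebesgue_tuple_ge0.
by apply: IH => t /=; exact: AB.
Qed.

Lemma lebesgue_tuple0 (m : nat) : @lebesgue_tuple R m set0 = 0%E.
Proof.
elim: m => [|m IH]; first by rewrite /= measure0.
by rewrite lebesgue_tupleS; under eq_integral do rewrite IH; rewrite integral0.
Qed.

(** [q] is the squared radius; negative values are allowed so that every slice of a ball is again a
    [tuple_ball]. *)
Definition tuple_ball (m : nat) (q : R) : set (m.-tuple R) :=
  [set t | \sum_(i < m) tnth t i ^+ 2 <= q].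

Lemma tuple_ball_lt0 (m : nat) (q : R) : q < 0 -> tuple_ball m q = set0.
Proof.
move=> q_lt0; apply/seteqP; split => // t; rewrite /tuple_ball /= leNgt => /negP; apply.
by rewrite (lt_le_trans q_lt0)// sumr_ge0// => i _; rewrite sqr_ge0.
Qed.

Lemma lebesgue_tuple_ballS (m : nat) (q : R) :
  @lebesgue_tuple R m.+1 (tuple_ball m.+1 q) =
  (\int[lebesgue_measure]_x @lebesgue_tuple R m (tuple_ball m (q - x ^+ 2)%R))%E.
Proof.
rewrite lebesgue_tupleS; apply: eq_integral => x _; congr lebesgue_tuple.
have E t : \sum_(i < m.+1) tnth (cons_pair (x, t)) i ^+ 2 =
    x ^+ 2 + \sum_(i < m) tnth t i ^+ 2.
  rewrite big_ord_recl; congr (_ + _).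
  by apply: eq_bigr => i _; rewrite !(tnth_nth 0).
by apply/seteqP; split => t; rewrite /tuple_ball /= E lerBrDl.
Qed.

(** Induction by slicing: the slice at [rho * x] has squared radius [rho ^ 2 (1 - x ^ 2)], so
    dilating the outer variable by [rho] extracts [rho ^ m.+1]. The constant is the volume of the
    unit ball. *)
Lemma lebesgue_tuple_ball (m : nat) :
  exists2 kappa : R, 0 <= kappa &
    forall rho : R, 0 <= rho ->
      @lebesgue_tuple R m (tuple_ball m (rho ^+ 2)) = (kappa * rho ^+ m)%:E.
Proof.
elim: m => [|m [kappa kappa_ge0 IH]].
  exists 1 => // rho rho_ge0; rewrite expr0 mulr1 /= diracE.
  by rewrite mem_set//= /tuple_ball /= big_ord0 sqr_ge0.
(* The indicator matters for [m = 0]: outside [[-1, 1]] the square root is 0, but its zeroth power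
   is 1. *)
pose unit_section (x : R) : \bar R :=
  (kappa * Num.sqrt (1 - x ^+ 2) ^+ m * \1_(`[-1, 1]%classic) x)%:E.
have sectionE (rho x : R) : 0 < rho ->
    @lebesgue_tuple R m (tuple_ball m (rho ^+ 2 - (rho * x) ^+ 2)) =
    ((rho ^+ m)%:E * unit_section x)%E.
  move=> rho_gt0; rewrite (_ : _ - _ = rho ^+ 2 * (1 - x ^+ 2)); last by ring.
  rewrite /unit_section indicE.
  have -> : (x \in `[-1, 1]%classic) = (x ^+ 2 <= 1).
    by rewrite mem_setE in_itv /= -ler_norml -ler_sqr ?nnegrE// expr1n real_normK ?num_real.
  have [x1|x1] := leP (x ^+ 2) 1.
    rewrite -(@sqr_sqrtr _ (1 - x ^+ 2)) ?subr_ge0// -exprMn IH; last first.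
      by rewrite mulr_ge0 ?sqrtr_ge0 ?ltW.
    by rewrite -EFinM; congr EFin; rewrite exprMn sqr_sqrtr ?subr_ge0// mulr1; ring.
  rewrite tuple_ball_lt0; last by rewrite pmulr_rlt0 ?exprn_gt0// subr_lt0.
  by rewrite lebesgue_tuple0 mulr0 mule0.
have unit_ge0 x : (0 <= unit_section x)%E.
  by rewrite lee_fin mulr_ge0 ?mulr_ge0 ?exprn_ge0 ?sqrtr_ge0 ?indicE ?ler0n.
have munit : measurable_fun setT unit_section.
  apply/measurable_EFinP; apply: measurable_funM; last exact: measurable_indic.
  apply: measurable_funM => //; apply: measurable_funX.
  apply: measurableT_comp.
    by apply: nondecreasing_measurable => // u v; exact: ler_wsqrtr.
  by apply: measurable_funB => //; exact: exprn_measurable.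
have int_le : (\int[lebesgue_measure]_x unit_section x <= (kappa * 2)%:E)%E.
  apply: (@le_trans _ _ (\int[lebesgue_measure]_x (kappa%:E * (\1_(`[-1, 1]%classic : set R) x)%:E))%E).
    apply: ge0_le_integral_nonmeas => // x.
    rewrite -EFinM lee_fin ler_wpM2r ?indicE ?ler0n//.
    rewrite ler_piMr// exprn_ile1 ?sqrtr_ge0// -[leRHS]sqrtr1 ler_wsqrtr//.
    by rewrite gerBl sqr_ge0.
  rewrite ge0_integralZl//=; last first.
    by apply/measurable_EFinP; exact: measurable_indic.
  rewrite integral_indic//= setIT lebesgue_measure_itv/= lte_fin.
  by rewrite ifT; [rewrite -EFinB -EFinM lee_fin; lra|lra].
pose kappa' : R := fine (\int[lebesgue_measure]_x unit_section x)%E.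
have kappaE : (\int[lebesgue_measure]_x unit_section x = kappa'%:E)%E.
  rewrite /kappa' fineK// ge0_fin_numE; last exact: integral_ge0.
  exact: le_lt_trans int_le (ltry _).
exists kappa' => [|rho]; first by rewrite fine_ge0// integral_ge0.
(* Dilation needs [rho > 0]. For [rho = 0] only the slice at 0 can be nonempty, and a single point
   has measure zero. *)
rewrite le_eqVlt => /predU1P[<-|rho_gt0].
  have sq0 : (0 : R) ^+ 2 = 0 by rewrite expr0n.
  rewrite lebesgue_tuple_ballS [0 ^+ m.+1]exprS mul0r mulr0 sq0.
  transitivity (\int[lebesgue_measure]_x
      ((kappa * 0 ^+ m)%:E * (\1_([set 0] : set R) x)%:E))%E.
    apply: eq_integral => x _; rewrite indicE sub0r.
    have [->|x_neq0] := eqVneq x 0.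
      rewrite mem_set// mule1; have := IH 0 (lexx _).
      by rewrite sq0 oppr0.
    rewrite tuple_ball_lt0; last by rewrite oppr_lt0 exprn_even_gt0.
    rewrite lebesgue_tuple0 memNset ?mule0//=; exact/eqP.
  rewrite ge0_integralZl//= ?lee_fin ?mulr_ge0 ?exprn_ge0//; last first.
    by apply/measurable_EFinP; exact: measurable_indic.
  by rewrite integral_indic//= setIT lebesgue_measure_set1 mule0.
rewrite lebesgue_tuple_ballS (@lebesgue_integral_dilate _ rho)//; last 2 first.
- have -> : (fun x : R => @lebesgue_tuple R m (tuple_ball m (rho ^+ 2 - x ^+ 2))) =
      (fun x => (rho ^+ m)%:E * unit_section (rho^-1 * x)%R)%E.
    by apply/funext => x; rewrite -sectionE// mulVKf ?gt_eqF.
  apply: measurable_funeM; apply: measurableT_comp munit _.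
  exact: mulrl_measurable.
- by move=> x; exact: lebesgue_tuple_ge0.
under eq_integral do rewrite sectionE//.
rewrite ge0_integralZl//= ?lee_fin ?exprn_ge0 ?ltW// kappaE.
by rewrite -!EFinM exprS; congr EFin; ring.
Qed.
End LebesgueTuple.

Section Volume.
Context (R : realType) (d : nat).

Lemma le_vol (A B : set 'rV[R]_d) : A `<=` B -> (vol A <= vol B)%E.
Proof. by move=> AB; apply: le_lebesgue_tuple => t /=; exact: AB. Qed.

Lemma vol_euclid_cball :
  exists2 kappa : R, 0 <= kappa &
    forall r : R, 0 <= r -> vol (euclid_cball d r) = (kappa * r ^+ d)%:E.
Proof.
have [kappa kappa_ge0 H] := lebesgue_tuple_ball R d.
exists kappa => // r r_ge0; rewrite -H// /vol; congr lebesgue_tuple.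
apply/seteqP; split => t /=.
  move=> /(euclid_cballE _ _ _ _ r_ge0); rewrite /dot /tuple_ball /=.
  by under eq_bigr do rewrite mxE -expr2.
move=> tr; apply/(euclid_cballE _ _ _ _ r_ge0); rewrite /dot.
by under eq_bigr do rewrite mxE -expr2.
Qed.

End Volume.

(** * Finiteness of the set of lattice polytopes in a ball *)

Lemma finite_powerset_set (T : choiceType) (F : set T) :
  finite_set F -> finite_set [set S | S `<=` F].
Proof.
move=> finF; pose powerF := fpowerset (fset_set F).
apply: (@sub_finite_set _ _ ((fun B : {fset T} => [set` B]) @` [set` powerF])).
  move=> S /= SF; have finS := sub_finite_set SF finF.
  exists (fset_set S); last by rewrite fset_setK.
  rewrite /= fpowersetE; apply/fsubsetP => x.
  by rewrite !in_fset_set// !inE; exact: SF.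
by apply: finite_image; exact: finite_fset.
Qed.

Section Polytopes.
Context (R : realType) (d : nat).

Lemma finite_lattice_ball (m : R) :
  finite_set (@int_lattice R d `&` [set x | dot x x <= m]).
Proof.
pose n := (Num.truncn `|m|).+1.
pose pt (f : {ffun 'I_d -> 'I_(2 * n).+1}) : 'rV[R]_d := \row_i ((f i)%:R - n%:R).
apply: (@sub_finite_set _ _ (range pt)); last exact: finite_image.
move=> x [xint xm].
have xn i : `|x 0 i| <= n%:R.
  have mn : `|m| < n%:R by rewrite -truncn_lt_nat ?normr_ge0 //= /n ltnS.
  have x2 : `|x 0 i| ^+ 2 <= n%:R.
    rewrite real_normK ?num_real//; apply: le_trans (ltW mn).
    exact: le_trans (coord_sqr_le_dot _ _ x i) (le_trans xm (ler_norm _)).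
  have n1 : 1 <= n%:R :> R by rewrite ler1n.
  rewrite leNgt; apply/negP => lt_nx; nra.
exists [ffun i => inord `|Num.floor (x 0 i + n%:R)|] => //.
apply/rowP => i; rewrite !mxE ffunE.
have /andP[xn1 xn2] : - n%:R <= x 0 i <= n%:R by rewrite -ler_norml.
have := xint i; rewrite intrEfloor => /eqP; set z := Num.floor (x 0 i) => zE.
have zn1 : (- n%:Z <= z) by rewrite -(ler_int R) zE mulrNz.
have zn2 : (z <= n%:Z) by rewrite -(ler_int R) zE.
rewrite -zE !pmulrn -intrD intrKfloor inordK; last by lia.
by rewrite -intrB; congr (_%:~R); lia.
Qed.

(** Each such polytope is the hull of a subset of the finitely many lattice points of the ball.
    Finiteness makes the cardinality of [fset_set] meaningful, since an infinite set is sent to the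
    empty one. *)
Lemma finite_lattice_polytopes (r : R) : 0 <= r ->
  finite_set (lattice_polytopes_in_ball d r).
Proof.
move=> r_ge0.
pose F := @int_lattice R d `&` [set x | dot x x <= r ^+ 2].
apply: (@sub_finite_set _ _ (@convex_hull R d @` [set S | S `<=` F])); last first.
  apply: finite_image; apply: finite_powerset_set; exact: finite_lattice_ball.
move=> P [[[S [_ Sint ->]] _] Pr]; exists S => // x Sx; split; first exact: Sint.
by apply/(euclid_cballE _ _ _ _ r_ge0); apply: Pr; exact: sub_convex_hull.
Qed.

End Polytopes.

(** * Distinct polytopes from subfamilies of a separated family *)

Section ShellPolytopes.
Context (R : realType) (d : nat) (I : finType) (G : {set I}) (pt : I -> 'rV[R]_d).
Variables (M L : R).
Hypothesis pt_int : forall i, i \in G -> int_lattice (pt i).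
Hypothesis pt_le : forall i, i \in G -> dot (pt i) (pt i) <= M.
Hypothesis pt_gt : forall i, i \in G -> M - L < dot (pt i) (pt i).
Hypothesis pt_sep : forall i j, i \in G -> j \in G -> i != j ->
  L <= dot (pt i - pt j) (pt i - pt j).
Hypothesis L_ge0 : 0 <= L.

(** The inner lattice points are always kept: they force the hull to contain a large ball, whatever
    [Y] is. *)
Definition shell_vertices (Y : {set I}) : set 'rV[R]_d :=
  (pt @` [set` Y]) `|` (@int_lattice R d `&` [set x | dot x x <= M - L]).

Definition shell_polytope (Y : {set I}) := convex_hull (shell_vertices Y).

Lemma shell_vertices_finite (Y : {set I}) : finite_set (shell_vertices Y).
Proof.
rewrite finite_setU; split; last exact: finite_lattice_ball.
by apply: finite_image; exact: finite_finset.
Qed.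

Lemma shell_vertices_int (Y : {set I}) : Y \subset G ->
  shell_vertices Y `<=` @int_lattice R d.
Proof.
by move=> /fintype.subsetP YG x [[i /YG iG <-]|[]//]; exact: pt_int.
Qed.

Lemma shell_vertices_le (Y : {set I}) x : Y \subset G ->
  shell_vertices Y x -> dot x x <= M.
Proof.
move=> /fintype.subsetP YG [[i /YG iG <-]|[_ /= xm]]; first exact: pt_le.
by apply: le_trans xm _; rewrite gerBl.
Qed.

(* For [i] not in [Y], all the vertices [x] satisfy
   [2 <x, pt i> <= |x|^2 + |pt i|^2 - |x - pt i|^2 < 2 |pt i|^2]. *)
Lemma mem_shell_polytope (Y : {set I}) i : Y \subset G -> i \in G ->
  shell_polytope Y (pt i) <-> i \in Y.
Proof.
move=> YG iG; split=> [|iY]; last by apply: sub_convex_hull; left; exists i.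
apply: contraPT => iY Pi.
have : dot (pt i) (pt i) < dot (pt i) (pt i); last by rewrite ltxx.
have := Pi; apply: (convex_hull_min _ _ _ _ (convex_half_space _ _ (pt i) _)).
have i_gt := pt_gt i iG.
move=> x [[j /= jY <-]|[_ /= xm]].
  have jG := fintype.subsetP YG j jY.
  have ij : i != j by apply: contra iY => /eqP->.
  have := pt_sep i j iG jG ij; have := pt_le j jG.
  by rewrite dot_sub; lra.
by have := dot_ge0 _ _ (pt i - x); rewrite dot_sub; lra.
Qed.

Lemma shell_polytope_inj : {in powerset G &, injective shell_polytope}.
Proof.
move=> Y Z; rewrite !finset.inE => YG ZG YZ; apply/setP => i.
have [iG|iG] := boolP (i \in G).
  by apply/idP/idP => /mem_shell_polytope; rewrite ?YZ -?YZ => /(_ _ iG)Pi;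
    apply/mem_shell_polytope; rewrite ?YZ -?YZ//; exact: Pi.
by rewrite (contraNF (fintype.subsetP YG i) iG) (contraNF (fintype.subsetP ZG i) iG).
Qed.

Lemma shell_polytope_in_ball (r : R) (Y : {set I}) : 0 <= r -> M <= r ^+ 2 ->
    (1 + d%:R) ^+ 2 <= M - L -> Y \subset G ->
  lattice_polytopes_in_ball d r (shell_polytope Y).
Proof.
move=> r_ge0 Mr ML YG; split; last first.
  apply: convex_hull_min; first exact: convex_euclid_cball.
  move=> x xY; apply/(euclid_cballE _ _ _ _ r_ge0).
  exact: le_trans (shell_vertices_le Y x YG xY) Mr.
split; last first.
  apply: affine_hull_cball1; apply: (lattice_hull_sub_cball _ _ (M - L)) => //.
  exact: subsetUr.
exists (shell_vertices Y); split=> //; first exact: shell_vertices_finite.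
exact: shell_vertices_int.
Qed.

Lemma card_shell_polytopes (S : set (set 'rV[R]_d)) : finite_set S ->
    (forall Y : {set I}, Y \subset G -> S (shell_polytope Y)) ->
  (2 ^ #|G| <= #|` fset_set S|)%N.
Proof.
move=> finS SY; rewrite -card_powerset cardE.
rewrite -(size_map shell_polytope); apply: uniq_leq_size.
  rewrite map_inj_in_uniq ?enum_uniq// => Y Z; rewrite !mem_enum.
  exact: shell_polytope_inj.
move=> P /mapP[Y]; rewrite mem_enum finset.inE => YG ->.
by rewrite in_fset_set// inE; exact: SY.
Qed.

End ShellPolytopes.

(** * Choice of the scale and size of the family *)

Lemma exists_scale (k D N : nat) : (0 < D)%N -> (D <= N)%N ->
  exists2 s, (0 < s)%N & (D * s ^ k.+3 <= N < D * s.+1 ^ k.+3)%N.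
Proof.
move=> D_gt0 DN; pose P s := (D * s ^ k.+3 <= N)%N.
have P1 : P 1 by rewrite /P exp1n muln1.
have Pmax s : P s -> (s <= N)%N.
  apply: leq_trans; apply: leq_trans (leq_pmull _ D_gt0).
  by case: s => // s; rewrite expnS leq_pmulr// expn_gt0.
have [s Ps smax] := ex_maxnP (ex_intro P _ P1) Pmax.
exists s; first exact: smax.
apply/andP; split; first exact: Ps.
by rewrite ltnNge; apply/negP => PS; have := smax s.+1 PS; rewrite ltnn.
Qed.

(** There are at most [3 N / s ^ 2] windows and [N = O(s ^ k.+3)], so the exponent of [s] is
    [k.+3 * k.+1 + 2 - k.+3 = k.+1 * k.+2]. *)
Lemma card_lower_bound (k b D N s g : nat) :
    (0 < b)%N -> (0 < s)%N -> (s ^ 2 <= N)%N -> (N < D * s.+1 ^ k.+3)%N ->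
    ((2 * (b * s ^ k.+3)) ^ k.+1 <= 2 * g * ((2 * N) %/ s ^ 2).+1)%N ->
  (s ^ (k.+1 * k.+2) <= 6 * (D * 2 ^ k.+3) * g)%N.
Proof.
move=> b_gt0 s_gt0 sN ND H.
have s2_gt0 : (0 < s ^ 2)%N by rewrite expn_gt0 s_gt0.
have step1 : (s ^ (k.+3 * k.+1) * s ^ 2 <= 2 * g * (3 * N))%N.
  apply: (@leq_trans (2 * g * ((2 * N) %/ s ^ 2).+1 * s ^ 2)).
    rewrite leq_mul2r; apply/orP; right; apply: leq_trans H.
    rewrite expnM leq_exp2r// mulnA leq_pmull// muln_gt0 b_gt0//.
  rewrite -mulnA leq_mul2l mulSn; apply/orP; right.
  by have := leq_divM (2 * N) (s ^ 2); lia.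
have step2 : (N <= D * 2 ^ k.+3 * s ^ k.+3)%N.
  apply: (leq_trans (ltnW ND)); rewrite -mulnA leq_mul2l -expnMn leq_exp2r//.
  by apply/orP; right; lia.
have : (s ^ (k.+1 * k.+2) * s ^ k.+3 <= 6 * (D * 2 ^ k.+3) * g * s ^ k.+3)%N.
  rewrite -expnD (_ : _ + _ = k.+3 * k.+1 + 2)%N; last by lia.
  rewrite expnD; apply: leq_trans step1 _.
  apply: (@leq_trans (2 * g * (3 * (D * 2 ^ k.+3 * s ^ k.+3)))%N).
    by rewrite !leq_mul2l step2 !orbT.
  by apply/eq_leq; lia.
by rewrite leq_pmul2r// expn_gt0 s_gt0.
Qed.

(** With [d = k.+2], the family has size at least of order [s ^ (d (d - 1))], while [N] is at most
    of order [s ^ (d + 1)]. *)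
Lemma separated_lattice_points (k : nat) :
  exists C : nat, forall N : nat, (C <= N)%N ->
    exists (s n M : nat) (G : {set {ffun 'I_k.+1 -> 'I_n}}),
    [/\ (N <= C * s ^ k.+3)%N, (s ^ (k.+1 * k.+2) <= C * #|G|)%N,
        ((N - 2) ^ 2 + s ^ 2 <= M <= N ^ 2)%N,
        (forall f, f \in G -> (point_norm N f <= M < point_norm N f + s ^ 2)%N) &
        (forall f g, f \in G -> g \in G -> f != g ->
          (s ^ 2)%:Z <= point_dist N f g)].
Proof.
(* [D] is chosen so that [n = 2 b s ^ k.+3], just large enough for the bad points to be a minority,
   gives [4 * k.+2 * n = D s ^ k.+3 <= N]. *)
pose b := bad_const k; pose D := (4 * k.+2 * (2 * b))%N.
have b_gt0 : (0 < b)%N by rewrite /b /bad_const !muln_gt0 /= expn_gt0.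
exists (6 * (D * 2 ^ k.+3))%N => N CN.
have D8 : (8 <= D)%N by rewrite /D; lia.
have DN : (8 * D <= N)%N.
  have pow8 : (8 <= 2 ^ k.+3)%N by rewrite (@leq_exp2l 2 3).
  apply: leq_trans CN; apply: (@leq_trans (D * 2 ^ k.+3)); last by rewrite leq_pmull.
  by rewrite mulnC leq_mul2l pow8 orbT.
have D_gt0 : (0 < D)%N by lia.
have le_DN : (D <= N)%N by lia.
have [s s_gt0 /andP[sN Ns]] := exists_scale k D N D_gt0 le_DN.
pose n := (2 * (b * s ^ k.+3))%N.
have nN : (4 * k.+2 * n <= N)%N by apply: leq_trans sN; apply/eq_leq; rewrite /n /D; lia.
have s2N : (8 * s ^ 2 <= N)%N.
  by apply: leq_trans sN; apply: leq_mul => //; rewrite leq_pexp2l.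
have [j [jN Gj]] := card_good_shell k n N nN s s_gt0 (leqnn _).
pose G : {set {ffun 'I_k.+1 -> 'I_n}} := finset (fun f => ~~ bad k n N s f &&
       ((N ^ 2 - point_norm N f) %/ s ^ 2 == j)%N).
have s2_gt0 : (0 < s ^ 2)%N by rewrite expn_gt0 s_gt0.
have shell f : f \in G ->
    (point_norm N f <= N ^ 2 - j * s ^ 2 < point_norm N f + s ^ 2)%N.
  rewrite finset.inE => /andP[_ /eqP E].
  have := point_norm_bounds k n N nN f.
  have := divn_eq (N ^ 2 - point_norm N f) (s ^ 2); rewrite E.
  by have := ltn_pmod (N ^ 2 - point_norm N f) s2_gt0; lia.
exists s, n, (N ^ 2 - j * s ^ 2)%N, G; split => //.
- apply: (leq_trans (ltnW Ns)).
  rewrite (_ : 6 * _ * _ = D * (6 * (2 ^ k.+3 * s ^ k.+3)))%N; last by lia.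
  rewrite leq_mul2l; apply/orP; right; apply: (@leq_trans (2 ^ k.+3 * s ^ k.+3)%N).
    by rewrite -expnMn leq_exp2r//; lia.
  by rewrite leq_pmull.
- apply: (@card_lower_bound k b D N s) => //; first lia.
  by move: Gj; rewrite (_ : #|[pred f | _ & _]| = #|G|)//; apply: eq_card => f; rewrite !finset.inE.
(* The window lies at most [2 N] below [N ^ 2] and [s ^ 2 <= N / 8]; together this is less than
   [4 N - 4]. *)
- apply/andP; split; last exact: leq_subr.
  have N2 : (N = (N - 2) + 2)%N by lia.
  by move: (N - 2)%N N2 => N' N2; rewrite N2 in jN s2N DN *; lia.
- move=> f g fG gG fg; have := shell f fG; have := shell g gG => sg sf.
  apply: (good_separated k n N nN) => //; try lia.
  by move: fG; rewrite finset.inE => /andP[].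
Qed.

(** * The integer points as real vectors *)

Section LatticeVectors.
Context (R : realType) (k n N : nat).
Local Notation fn := {ffun 'I_k.+1 -> 'I_n}.

Definition point_vec (f : fn) : 'rV[R]_k.+2 :=
  \row_j if unlift ord0 j is Some i then (f i)%:R else (height N f)%:R.

Lemma point_vec_int f : int_lattice (point_vec f).
Proof. by move=> j; rewrite mxE; case: unlift => *; exact: natr_int. Qed.

Lemma dot_point_vec f :
  dot (point_vec f) (point_vec f) = (point_norm N f)%:R.
Proof.
rewrite /dot big_ord_recl !mxE unlift_none natrD natrX expr2; congr (_ + _).
rewrite natr_sum; apply: eq_bigr => i _.
by rewrite !mxE liftK natrX expr2.
Qed.

Lemma dot_point_vecB f g :
  dot (point_vec f - point_vec g) (point_vec f - point_vec g) =
  (point_dist N g f)%:~R.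
Proof.
rewrite /dot big_ord_recl !mxE unlift_none intrD rmorphXn /= intrB expr2.
congr (_ + _); rewrite rmorph_sum; apply: eq_bigr => i _.
by rewrite !mxE liftK rmorphXn /= intrB expr2.
Qed.

End LatticeVectors.

(** * Asymptotic estimates and the final assembly *)

(** Bernoulli's inequality in homogeneous form; it bounds the volume of the shell between the radii
    [r - x] and [r]. *)
Lemma bernoulli_subr (R : realDomainType) (d : nat) (x r : R) :
  0 <= x -> x <= r -> r ^+ d - d%:R * x * r ^+ d.-1 <= (r - x) ^+ d.
Proof.
move=> x_ge0 xr; have r_ge0 := le_trans x_ge0 xr.
elim: d => [|[|d] IH]; first by rewrite !expr0 !mul0r subr0.
  by rewrite !expr1 expr0 mul1r mulr1.
rewrite [leRHS]exprS; apply: (@le_trans _ _ ((r - x) * (r ^+ d.+1 - d.+1%:R * x * r ^+ d))).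
  rewrite /= [r ^+ d.+2]exprS [r ^+ d.+1]exprS (natrD _ 1 d.+1).
  rewrite -subr_ge0.
  rewrite (_ : _ - _ = d.+1%:R * x ^+ 2 * r ^+ d); last by ring.
  by rewrite !mulr_ge0 ?sqr_ge0 ?exprn_ge0.
by rewrite ler_wpM2l ?subr_ge0.
Qed.

Lemma bigO_littleo_monomial (R : realType) (K : R) (d : nat) : (0 < d)%N ->
  ((fun r : R => K * r ^+ d.-1) =O_ +oo (fun r : R => r ^+ d.-1)) /\
  ((fun r : R => K * r ^+ d.-1) =o_ +oo (fun r : R => r ^+ d)).
Proof.
move=> d_gt0; split.
  apply/eqO_exP; exists (`|K| + 1); first by rewrite ltr_wpDl.
  by apply: nearW => r; rewrite normrM ler_wpM2r// lerDl.
apply/eqoP => e e_gt0; near=> r.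
have r_gt0 : 0 < r by near: r; exact: nbhs_pinfty_gt.
rewrite -[d in leRHS]prednK// exprS !normrM mulrA ler_wpM2r//.
rewrite -ler_pdivrMl// (ger0_norm (ltW r_gt0)).
by near: r; apply: nbhs_pinfty_ge; exact: num_real.
Unshelve. all: by end_near. Qed.

(** With [d = k.+2] the exponents combine as [(d + 1) d (d - 1) / (d + 1) = d (d - 1)], which is the
    order of the size of the separated family. *)
Lemma powR_volume_bound (R : realType) (k s V : nat) (C : R) : 0 <= C ->
    V%:R <= C * (s%:R ^+ k.+3) ^+ k.+2 ->
  V%:R `^ ((k.+2%:R - 1) / (k.+2%:R + 1)) <=
    C `^ ((k.+2%:R - 1) / (k.+2%:R + 1)) * (s ^ (k.+1 * k.+2))%:R.
Proof.
move=> C_ge0 VC; set a := (_ / _).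
have a_ge0 : 0 <= a.
  by rewrite divr_ge0// ?addr_ge0// subr_ge0 ler1n.
have X_ge0 : 0 <= (s%:R ^+ k.+3) ^+ k.+2 :> R by rewrite !exprn_ge0.
apply: (@le_trans _ _ ((C * (s%:R ^+ k.+3) ^+ k.+2) `^ a)).
  by apply: ge0_ler_powR VC; rewrite ?nnegrE ?(mulr_ge0 C_ge0 X_ge0).
rewrite powRM// ler_wpM2l ?powR_ge0//.
rewrite -exprM -powR_mulrn// -powRrM natrX -powR_mulrn//.
rewrite [X in _ `^ X <= _](_ : _ = (k.+1 * k.+2)%:R)//.
rewrite /a !natrM -[k.+3]addn1 -[k.+2]addn1 -[k.+1]addn1 !natrD.
by field; have : 0 <= k%:R :> R by []; lra.
Qed.

Theorem theorem5p4 (R : realType) (d : nat) (hd : (2 <= d)%N) :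
  exists (c : R -> R) (c_d r0 : R),
    [/\ (c =O_ +oo (fun r : R => r ^+ d.-1)),
        (c =o_ +oo (fun r : R => r ^+ d)),
        0 < c_d &
        forall (r : R) (V : nat), r0 <= r -> (0 < V)%N ->
          ((V%:R / (d`!)%:R)%:E <= vol (euclid_cball d r))%E ->
          V%:R `^ ((d%:R - 1) / (d%:R + 1)) <=
            c_d * ln (#|` fset_set
              [set P | lattice_polytopes_in_ball d r P /\
                (vol (euclid_cball d r) - (c r)%:E <= vol P)%E] |%:R)].
Proof.
case: d hd => [|[|k]]// _; set d := k.+2.
have [kappa kappa_ge0 volE] := vol_euclid_cball R d.
have [C HC] := separated_lattice_points k.
(* From [V <= d! kappa r ^ d] and [r <= 2 C s ^ k.+3]; the [+ 1] makes [A] positive. *)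
pose A : R := (d`!)%:R * kappa * (2 * C%:R) ^+ d + 1.
(* [C + 1] keeps the constant positive even for [C = 0], and [ln 2] comes from the [2 ^ #|G|]
   polytopes. *)
pose c_d : R := A `^ ((d%:R - 1) / (d%:R + 1)) * (C%:R + 1) / ln 2.
(* The polytopes contain the ball of radius [r - (3 + d)]: 3 is lost down to the inner lattice
   points, and [d] by rounding to the lattice. *)
pose c (r : R) : R := kappa * d%:R * (3 + d%:R) * r ^+ d.-1.
have fk_ge0 : 0 <= (d`!)%:R * kappa by rewrite mulr_ge0.
have pow_ge0 : 0 <= (2 * C%:R) ^+ d :> R by rewrite exprn_ge0// mulr_ge0.
have A_gt0 : 0 < A by rewrite ltr_wpDl// (mulr_ge0 fk_ge0 pow_ge0).
have ln2_gt0 : 0 < ln 2 :> R by rewrite ln_gt0// ltr1n.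
have [cO co] := @bigO_littleo_monomial R (kappa * d%:R * (3 + d%:R)) d isT.
(* This threshold gives [N >= C], [N >= 3] and [1 + d <= r - 3]; the last puts the unit ball inside
   every polytope. *)
exists c, c_d, (C%:R + d%:R + 4); split => //.
  by rewrite divr_gt0// mulr_gt0 ?powR_gt0// ltr_wpDl.
move=> r V r0_le V_gt0 Vvol; set S := [set P | _].
have C_ge0 : 0 <= C%:R :> R by [].
have d_ge0 : 0 <= d%:R :> R by [].
have r_ge0 : 0 <= r by lra.
pose N := Num.truncn r.
have /andP[Nr rN] := truncn_itv r_ge0; rewrite -/N -natr1 in Nr rN.
have CN : (C <= N)%N by rewrite -(ler_nat R); lra.
have N3 : (3 <= N)%N by rewrite -(ltr_nat R); lra.
have [s [n [M [G [Ns sG /andP[M_ge M_le] shell sep]]]]] := HC N CN.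
pose L : R := (s ^ 2)%:R.
have L_ge0 : 0 <= L by rewrite ler0n.
have ML : (r - 3) ^+ 2 <= M%:R - L.
  rewrite /L lerBrDr; apply: le_trans (_ : ((N - 2) ^ 2 + s ^ 2)%:R <= _); last by rewrite ler_nat.
  by rewrite natrD !natrX natrB ?(ltnW N3)// lerD2r ler_sqr ?nnegrE; lra.
have Mr : M%:R <= r ^+ 2.
  apply: (@le_trans _ _ (N%:R ^+ 2)); first by rewrite -natrX ler_nat.
  by rewrite ler_sqr ?nnegrE.
have pt_le f : f \in G -> dot (point_vec R k n N f) (point_vec R k n N f) <= M%:R.
  by move=> /shell /andP[fM _]; rewrite dot_point_vec ler_nat.
have pt_gt f : f \in G -> M%:R - L < dot (point_vec R k n N f) (point_vec R k n N f).
  by move=> /shell /andP[_ fM]; rewrite dot_point_vec ltrBlDr -natrD ltr_nat.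
have pt_sep f g : f \in G -> g \in G -> f != g ->
    L <= dot (point_vec R k n N f - point_vec R k n N g)
           (point_vec R k n N f - point_vec R k n N g).
  move=> fG gG fg; rewrite dot_point_vecB /L pmulrn ler_int.
  by apply: sep => //; rewrite eq_sym.
have finS : finite_set S.
  by apply: sub_finite_set (finite_lattice_polytopes R d r r_ge0) => P [].
have card_S : (2 ^ #|G| <= #|` fset_set S|)%N.
  apply: (card_shell_polytopes _ _ _ _ _ _ _ pt_le pt_gt pt_sep _ finS) => Y YG.
  have d1M : (1 + d%:R) ^+ 2 <= M%:R - L.
    by apply: le_trans ML; rewrite ler_sqr ?nnegrE; lra.
  split.
    apply: (shell_polytope_in_ball _ _ _ _ _ _ _ _ pt_le L_ge0 _ _ r_ge0 Mr d1M YG).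
    by move=> f _; exact: point_vec_int.
  pose rho := r - (3 + d%:R).
  have rho_ge0 : 0 <= rho by rewrite /rho; lra.
  have /le_vol : euclid_cball d rho `<=` shell_polytope R d _ (point_vec R k n N) M%:R L Y.
    apply: (lattice_hull_sub_cball _ _ (M%:R - L)) => //; last exact: subsetUr.
    by apply: le_trans ML; rewrite (_ : rho + _ = r - 3)// /rho; ring.
  apply: le_trans; rewrite !volE// -EFinB lee_fin.
  rewrite (_ : _ - c r = kappa * (r ^+ d - d%:R * (3 + d%:R) * r ^+ d.-1)); last first.
    by rewrite /c mulrBr -!mulrA.
  by rewrite ler_wpM2l// bernoulli_subr//; lra.
have V_le : V%:R <= A * (s%:R ^+ k.+3) ^+ k.+2.
  have V_le1 : V%:R <= (d`!)%:R * (kappa * r ^+ d).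
    by move: Vvol; rewrite volE// lee_fin ler_pdivrMr ?ltr0n ?fact_gt0// mulrC.
  apply: (le_trans V_le1); rewrite mulrA.
  (* The factor 2 absorbs the rounding: [r < N + 1 <= 2 N]. *)
  have r_le : r <= 2 * C%:R * s%:R ^+ k.+3.
    have NX : N%:R <= C%:R * s%:R ^+ k.+3 :> R by rewrite -natrX -natrM ler_nat.
    have N1 : 1 <= N%:R :> R by rewrite ler1n (leq_trans _ N3).
    rewrite -mulrA; move: (C%:R * _) NX => X NX.
    by clear -rN N1 NX; lra.
  apply: (@le_trans _ _ ((d`!)%:R * kappa * (2 * C%:R * s%:R ^+ k.+3) ^+ d)).
    by rewrite (ler_wpM2l fk_ge0)// lerXn2r ?nnegrE// (le_trans r_ge0).
  by rewrite exprMn mulrA ler_wpM2r ?exprn_ge0// lerDl.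
apply: (le_trans (powR_volume_bound R k s V A (ltW A_gt0) V_le)).
rewrite /c_d -!mulrA ler_wpM2l ?powR_ge0//.
have sG' : (s ^ (k.+1 * k.+2))%:R <= C%:R * #|G|%:R :> R by rewrite -natrM ler_nat.
have lnG : #|G|%:R * ln 2 <= ln (#|` fset_set S|%:R) :> R.
  rewrite mulr_natl -lnXn// -natrX ler_ln ?posrE ?ltr0n ?expn_gt0 ?ler_nat//.
  by rewrite (leq_trans _ card_S)// expn_gt0.
apply: (le_trans sG'); apply: (@le_trans _ _ ((C%:R + 1) * #|G|%:R)).
  by rewrite ler_wpM2r// lerDl.
by rewrite ler_wpM2l ?addr_ge0// mulrC ler_pdivlMr.
Qed.
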